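(* Let $b \ge 2$ be an integer. A positive integer $k$ has no comma-successor in base $b$ (or, equally, has no comma-child in base $b$) if and only if the base-$b$ representation of $k$ has the form $$(b-1)\,(b-1)\,\ldots\,(b-1)\,x\,y,$$ consisting of $i \ge 0$ digits equal to $b-1$ followed by the two digits $x$ and $y$, where $1 \le x \le b-2$ and $y = b-1-x$.
   Context: Fix a base $b \ge 2$. A digit is any integer between $0$ and $b-1$. For a positive integer $n$, let $\delta(n)$ denote its leading (most significant, nonzero) base-$b$ digit. For positive integers $k, k'$, we say that $k'$ is a comma-child of $k$ (in base $b$) if $k' - k = d\cdot b + \delta(k')$, where $d = k \bmod b$ is the last base-$b$ digit of $k$. If $k$ has at least one comma-child, the comma-successor of $k$ is its smallest comma-child; otherwise $k$ has no comma-successor. *)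

(* Defs.v *)
From mathcomp Require Import all_boot.

Set Implicit Arguments.
Unset Strict Implicit.
Unset Printing Implicit Defensive.

(* Base-b representation of n, most significant digit first, without leading
   zeros; meaningful for 1 < b and 0 < n, in which case trunc_log b n is the
   position of the most significant digit. *)
Definition digits (b n : nat) : seq nat :=
  rev (mkseq (fun i => n %/ b ^ i %% b) (trunc_log b n).+1).

Definition leading_digit (b n : nat) : nat := head 0 (digits b n).

(* k' - k = d * b + leading_digit b k' with d = k %% b, written additively
   because subtraction on nat is truncated. *)
Definition comma_child (b k k' : nat) : Prop :=
  k' = k + (k %% b * b + leading_digit b k').

Definition comma_successor (b k k' : nat) : Prop :=
  comma_child b k k' /\ forall m : nat, comma_child b k m -> k' <= m.

(* Main.v *)
(** Let [d] be the last digit of [k] and [s = k + d * b]: a comma-child of [k] is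
    a number [s + e] whose leading digit is [e].  Let [f] be the leading digit of
    [s].  If [s + f] still has leading digit [f], it is a child; if not, but
    [f + 1 < b], then [s + f + 1] is one.  The remaining case is
    [s = b ^ p - c] with [0 < c < b]: then [s + e] has leading digit [b - 1] for
    [e < c] and [1] for [e >= c], so a child exists only for [c = 1].
    Solving [k + d * b = b ^ p - c] modulo [b] gives [d = b - c], whence the
    digits of [k]. *)

Require Import Defs.
From mathcomp Require Import all_boot zify.

Definition eval_digits (b : nat) (s : seq nat) : nat :=
  foldl (fun n d => n * b + d) 0 s.

Lemma eval_digits_rcons b s d :
  eval_digits b (rcons s d) = eval_digits b s * b + d.
Proof. by rewrite /eval_digits foldl_rcons. Qed.

Lemma digits_small b r : 0 < r < b -> digits b r = [:: r].
Proof.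
case/andP=> r0 rb; have hb : 1 < b by apply: leq_ltn_trans r0 rb.
rewrite /digits (@trunc_log_eq b 0 r) ?expn0 ?expn1 ?r0 //=.
by rewrite /mkseq /= divn1 modn_small.
Qed.

Lemma digits_rcons b q r : 0 < q -> r < b -> 1 < b ->
  digits b (q * b + r) = rcons (digits b q) r.
Proof.
move=> q0 rb hb; have b0 : 0 < b by apply: ltnW.
have /andP[lo hi] := trunc_log_bounds hb q0.
rewrite /digits (@trunc_log_eq b (trunc_log b q).+1) //; last first.
  rewrite !(expnSr _ _.+1) expnSr in hi *; apply/andP; split; nia.
rewrite -[in RHS]rev_cons; congr rev.
(* Position 0 yields the last digit [r]; at each later position the extra factor [b] in [b ^ i.+1]
   divides [q * b + r] down to [q]. *)
rewrite /mkseq (_ : iota 0 _.+2 = 0 :: iota (1 + 0) (trunc_log b q).+1) //.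
rewrite iotaDl map_cons.
rewrite expn0 divn1 modnMDl modn_small //; congr (_ :: _).
rewrite -map_comp; apply: eq_map => i; rewrite [LHS]/=.
by rewrite add1n expnS divnMA divnMDl // (divn_small rb) addn0.
Qed.

Lemma digitsK b n : 1 < b -> 0 < n -> eval_digits b (digits b n) = n.
Proof.
move=> hb; have b0 : 0 < b by apply: ltnW.
elim/ltn_ind: n => n IH n0; case: (ltnP n b) => nb.
  by rewrite digits_small ?n0.
have q0 : 0 < n %/ b by rewrite divn_gt0.
rewrite {1}(divn_eq n b) digits_rcons ?ltn_pmod // eval_digits_rcons.
by rewrite IH ?ltn_Pdiv // -divn_eq.
Qed.

Lemma eval_digitsK b s : 1 < b -> 0 < head 0 s -> all (fun d => d < b) s ->
  0 < eval_digits b s /\ digits b (eval_digits b s) = s.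
Proof.
move=> hb; elim/last_ind: s => [|s d IH] //.
rewrite all_rcons eval_digits_rcons => h /andP[db sb].
case: s IH h sb => [|a s] IH h sb.
  by rewrite /= in h; rewrite /eval_digits /= digits_small ?h.
have [pos eqs] := IH h sb; split; first by nia.
by rewrite digits_rcons // eqs.
Qed.

Lemma eval_digits_nseq b i : 0 < b -> eval_digits b (nseq i (b - 1)) = b ^ i - 1.
Proof.
move=> b0; elim: i => [|i IH] //; rewrite -addn1 nseqD cats1 eval_digits_rcons IH.
have := expn_gt0 b i; rewrite b0 addn1 expnSr; nia.
Qed.

(** Turns the digit pattern into one arithmetic equation. Since [0 < x], the string has no leading
    zero even for [i = 0], so evaluation can be inverted. *)
Lemma digits_nseqP b k i x y : 1 < b -> 0 < k -> 0 < x < b -> y < b ->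
  digits b k = nseq i (b - 1) ++ [:: x; y] <->
  k = ((b ^ i - 1) * b + x) * b + y.
Proof.
move=> hb k0 /andP[x0 xb] yb; have b0 : 0 < b by apply: ltnW.
have ev : eval_digits b (nseq i (b - 1) ++ [:: x; y])
          = ((b ^ i - 1) * b + x) * b + y.
  by rewrite -[_ ++ _]cat_rcons cats1 !eval_digits_rcons eval_digits_nseq.
split=> [dE | ->]; first by rewrite -ev -dE digitsK.
rewrite -ev; apply: (proj2 (eval_digitsK _ _ hb _ _)).
  by case: i {ev} => //= i; rewrite subn_gt0.
by rewrite all_cat all_nseq /= xb yb subn1 prednK // leqnn orbT.
Qed.

Lemma leading_digitE b n : 1 < b -> 0 < n ->
  leading_digit b n = n %/ b ^ trunc_log b n.
Proof.
move=> hb n0; have /andP[_ hi] := trunc_log_bounds hb n0.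
rewrite /leading_digit /digits mkseqS rev_rcons /= modn_small //.
by rewrite ltn_divLR ?expn_gt0 ?(ltnW hb) // -expnS.
Qed.

(** The bounds force [trunc_log b n = p], so placing [n] in a block at any scale [p] certifies its
    leading digit. *)
Lemma leading_digit_unique b n p f : 0 < f < b ->
  f * b ^ p <= n < f.+1 * b ^ p -> leading_digit b n = f.
Proof.
case/andP=> f0 fb /andP[lo hi]; have hb : 1 < b by apply: leq_ltn_trans fb.
have bp : 0 < b ^ p by rewrite expn_gt0 (ltnW hb).
have tl : trunc_log b n = p.
  by apply: trunc_log_eq; rewrite ?expnS //; apply/andP; split; nia.
rewrite leading_digitE ?tl //; last by nia.
by apply/eqP; rewrite eqn_leq leq_divRL // -ltnS ltn_divLR // hi lo.
Qed.

Lemma leading_digit_bounds b n : 1 < b -> 0 < n ->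
  let p := trunc_log b n in let f := leading_digit b n in
  0 < f < b /\ f * b ^ p <= n < f.+1 * b ^ p.
Proof.
move=> hb n0 p f; have /andP[lo hi] := trunc_log_bounds hb n0.
have bp : 0 < b ^ p by rewrite expn_gt0 (ltnW hb).
rewrite /f leading_digitE // divn_gt0 // lo ltn_divLR // -expnS hi.
by rewrite leq_divM ltn_ceil.
Qed.

(** By [b <= s], the block of constant leading digit containing [s] and the next one have length at
    least [b], so adding a digit crosses at most one boundary. *)
Lemma no_leading_digit_offsetP b s : 1 < b -> b <= s ->
  (forall e, leading_digit b (s + e) <> e) <->
  exists p c, [/\ 0 < p, 1 < c < b & s + c = b ^ p.+1].
Proof.
move=> hb bs; split=> [noe | [p [c [p0 /andP[c1 cb] sc]]] e].
- have s0 : 0 < s by lia.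
  have [] := leading_digit_bounds b s hb s0.
  set p := trunc_log b s; set f := leading_digit b s => fb /andP[lo hi].
  have p0 : 0 < p by rewrite trunc_log_gt0 -ltnS prednK ?hb //; lia.
  have bbp : b <= b ^ p by rewrite -{1}(expn1 b) leq_exp2l.
  have /andP[f0 fltb] := fb.
  have sf : f.+1 * b ^ p <= s + f.
    rewrite leqNgt; apply/negP=> h; apply: (noe f).
    by apply: (@leading_digit_unique b _ p) => //; apply/andP; split; lia.
  (* Otherwise [s + f.+1] lies in the next block, because [f.+1 < b <= b ^ p]. *)
  have fE : f.+1 = b.
    apply/eqP; rewrite eqn_leq fltb leqNgt; apply/negP=> h.
    apply: (noe f.+1); apply: (@leading_digit_unique b _ p) => //.
    by apply/andP; split; nia.
  rewrite fE -expnS in hi sf.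
  exists p, (b ^ p.+1 - s); split=> //; last by lia.
  apply/andP; split; last by lia.
  (* A gap of 1 would make [s + 1] equal to [b ^ p.+1], whose leading digit is 1. *)
  rewrite ltnNge; apply/negP=> h; apply: (noe 1).
  apply: (@leading_digit_unique b _ p.+1) => //.
  rewrite mul1n; apply/andP; split; first by lia.
  have : b <= b ^ p.+1 by rewrite -{1}(expn1 b) leq_exp2l.
  by lia.
- have bbp : b <= b ^ p by rewrite -{1}(expn1 b) leq_exp2l.
  rewrite expnS in sc.
  move=> le; have n0 : 0 < s + e by lia.
  have [/andP[_ eb] _] := leading_digit_bounds b _ hb n0.
  (* For [e < c] the leading digit is [b - 1 >= c], hence not [e]; for [c <= e] it is 1, less than
     [c]. *)
  rewrite le in eb; case: (ltnP e c) => ec.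
    have : leading_digit b (s + e) = b.-1.
      by apply: (@leading_digit_unique b _ p); apply/andP; split; nia.
    by lia.
  have : leading_digit b (s + e) = 1.
    by apply: (@leading_digit_unique b _ p.+1);
       rewrite ?expnS; apply/andP; split; nia.
  by lia.
Qed.

Lemma comma_child_exists_offset b k :
  (exists k', comma_child b k k') <->
  (exists e, leading_digit b (k + k %% b * b + e) = e).
Proof.
split=> [[k' ck] | [e he]].
  by exists (leading_digit b k'); rewrite -addnA -ck.
by exists (k + k %% b * b + e); rewrite /comma_child he addnA.
Qed.

Lemma comma_successor_exists b k :
  (exists k', comma_successor b k k') <-> (exists k', comma_child b k k').
Proof.
split=> [[k' [ck _]] | [k' ck]]; first by exists k'.
(* Being a child is a decidable equation, so a least child can be extracted. *)
pose P m := m == k + (k %% b * b + leading_digit b m).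
have exP : exists m, P m by exists k'; apply/eqP.
exists (ex_minn exP); case: ex_minnP => m /eqP cm minm.
by split=> // n cn; apply: minm; apply/eqP.
Qed.

Lemma no_comma_childP b k : 1 < b -> 0 < k ->
  ~ (exists k', comma_child b k k') <->
  exists i x y, [/\ 1 <= x, x <= b - 2, y = b - 1 - x
    & digits b k = nseq i (b - 1) ++ [:: x; y]].
Proof.
move=> hb k0; have b0 : 0 < b by lia.
have bs : b <= k + k %% b * b.
  by case: (ltnP k b) => kb; [rewrite modn_small //; nia | lia].
have offset := no_leading_digit_offsetP b _ hb bs.
have child := comma_child_exists_offset b k.
split=> [nc | [i [x [y [x0 xb yE /digits_nseqP dE]]]] /child[e]].
- have [|p [c [p0 /andP[c1 cb] sc]]] := proj1 offset.
    by move=> e he; apply/nc/child; exists e.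
  case: p p0 sc => // i _ sc.
  have kE := divn_eq k b; have db := ltn_pmod k b0.
  set d := k %% b in sc kE db; set q := k %/ b in kE.
  (* Modulo [b] the equation [sc] says that [b] divides [d + c], and [0 < d + c < 2 * b]. *)
  have dc : d + c = b.
    have : b %| d + c.
      have : b %| b ^ i.+2 by rewrite expnS dvdn_mulr.
      rewrite -sc kE (_ : _ + c = (q + d) * b + (d + c)); last by lia.
      by rewrite dvdn_addr // dvdn_mull.
    by case/dvdnP=> [[|[|m]]]; lia.
  have qd : q + d + 1 = b ^ i.+1 by move: sc; rewrite expnS kE; nia.
  (* Here [q = b ^ i.+1 - 1 - d]: subtracting [d] from a string of [i.+1] digits [b - 1] changes
     only the last of them. *)
  exists i, (b - 1 - d), d; split; try lia.
  apply/digits_nseqP; try lia.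
  rewrite [LHS]kE; congr (_ * _ + _).
  have bi : 0 < b ^ i by rewrite expn_gt0 b0.
  by rewrite expnSr in qd; rewrite mulnBl; nia.
(* Since [x + y + 1 = b], adding [y * b + (b - y)] to [k] carries through every digit [b - 1] and
   gives [b ^ i.+2]. *)
- apply: (proj2 offset); exists i.+1, (b - y); split=> //; first by lia.
  have kE : k = ((b ^ i - 1) * b + x) * b + y by apply: dE; lia.
  have bi : 0 < b ^ i by rewrite expn_gt0 b0.
  rewrite {2}kE modnMDl modn_small; last by lia.
  rewrite kE !expnSr.
  case: (b ^ i) bi => // a _; rewrite subSS subn0.
  have -> : b = x + y + 1 by lia.
  by nia.
Qed.

Theorem theorem5p1 (b k : nat) (hb : 2 <= b) (hk : 0 < k) :
  let special :=
    exists i x y : nat,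
      [/\ 1 <= x, x <= b - 2, y = b - 1 - x
        & digits b k = nseq i (b - 1) ++ [:: x; y]] in
  ((~ exists k' : nat, comma_successor b k k') <-> special) /\
  ((~ exists k' : nat, comma_child b k k') <-> special).
Proof.
move=> special; have child := no_comma_childP b k hb hk.
have succ := comma_successor_exists b k.
by split=> //; rewrite /special; tauto.
Qed.
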